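(* Let $a,b,c,d$ be positive integers. If $d=a+b+c$, then the meander of type $\frac{d}{a|b|c}$ has index $\gcd(a+b,\,b+c)-1$. If $a+b=c+d$, then the meander of type $\frac{a|b}{c|d}$ has index $\gcd(a+b,\,b+c)-1$.
   Context: Let $n$ be a positive integer and let $(a_1,\ldots,a_k)$ and $(b_1,\ldots,b_m)$ be two ordered sequences of positive integers, each with sum $n$. The meander of type $\frac{a_1|a_2|\cdots|a_k}{b_1|b_2|\cdots|b_m}$ is the (multi)graph on vertices $v_1,\ldots,v_n$ placed left to right on a line, constructed as follows. Split $v_1,\ldots,v_n$ into consecutive top blocks of sizes $a_1,\ldots,a_k$, and also into consecutive bottom blocks of sizes $b_1,\ldots,b_m$. For each top block, with vertices $v_p,\ldots,v_q$, add the top edges $v_{p+i}v_{q-i}$ for all $i\ge 0$ with $p+i<q-i$. For each bottom block add bottom edges in the same way. A pair of vertices joined by both a top edge and a bottom edge forms a cycle. Every connected component is a path (possibly a single vertex) or a cycle. The index of the meander is $2C+P-1$, where $C$ is the number of cycles and $P$ the number of paths. (By Dergachev and Kirillov this equals the index of the associated seaweed subalgebra of $\mathfrak{sl}(n)$.) *)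

(* Defs.v *)
From HB Require Import structures.
From mathcomp Require Import all_boot all_order all_algebra.

Set Implicit Arguments.
Unset Strict Implicit.
Unset Printing Implicit Defensive.

(* A multigraph on V is a set of edges (l, e), where e is the set of endpoints
   and the label l : L distinguishes parallel edges. *)
Section Multigraph.
Variables (L V : finType) (G : {set L * {set V}}).

Definition adjacent : rel V :=
  [rel x y | [exists l : L, (l, [set x; y]) \in G]].

Definition components : {set {set V}} :=
  [set [set y | connect adjacent x y] | x : V].

Definition edges_in (K : {set V}) : {set L * {set V}} :=
  [set e in G | e.2 \subset K].

(* The edges q join successive vertices of the sequence x :: p. *)
Definition joins (x : V) (p : seq V) (q : seq (L * {set V})) : bool :=
  [seq e.2 | e <- q] == pairmap (fun u v => [set u; v]) x p.

(* The vertices of K can be listed without repetition as x :: p, and the edges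
   of G inside K as q, so that these form a path (of length 0 if p is empty). *)
Definition is_path (K : {set V}) : bool :=
  [exists x : V, exists p : #|K|.-1.-tuple V,
   exists q : #|K|.-1.-tuple (L * {set V}),
    [&& perm_eq (x :: p) (enum K), perm_eq q (enum (edges_in K))
      & joins x p q]].

(* Same with a closing edge from the last vertex back to x. Two vertices joined
   by two parallel edges form a cycle, since the edges in q are distinct. *)
Definition is_cycle (K : {set V}) : bool :=
  [exists x : V, exists p : #|K|.-1.-tuple V,
   exists q : #|K|.-tuple (L * {set V}),
    [&& perm_eq (x :: p) (enum K), perm_eq q (enum (edges_in K))
      & joins x (rcons p x) q]].

Definition num_paths : nat := #|[set K in components | is_path K]|.
Definition num_cycles : nat := #|[set K in components | is_cycle K]|.

End Multigraph.

(* The vertices v_1, ..., v_n are 0, ..., n - 1 in 'I_n. *)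
Definition block_first (s : seq nat) (j : nat) : nat := sumn (take j s).
Definition block_last (s : seq nat) (j : nat) : nat := (sumn (take j.+1 s)).-1.

Definition is_arc (n : nat) (s : seq nat) (x y : 'I_n) : bool :=
  [exists j : 'I_(size s), exists i : 'I_n,
    [&& block_first s j + i < block_last s j - i,
        x == block_first s j + i :> nat
      & y == block_last s j - i :> nat]].

Definition arcs (n : nat) (s : seq nat) : {set {set 'I_n}} :=
  [set [set x; y] | x in 'I_n, y in 'I_n & is_arc s x y].

(* Top edges are labelled true and bottom edges false. The number of vertices
   is read off the top sequence; the two sequences are meant to have positive
   entries and the same sum. *)
Definition meander (top bot : seq nat) : {set bool * {set 'I_(sumn top)}} :=
  [set (true, e) | e in arcs (sumn top) top]
    :|: [set (false, e) | e in arcs (sumn top) bot].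

Definition meander_index (top bot : seq nat) : int :=
  ((2 * num_cycles (meander top bot) + num_paths (meander top bot))%:Z - 1)%R.

(* Main.v *)
(* Each row of blocks acts on the vertices by an involution, the reversal of
   every block. In the graph of two involutions t and u, a component is an orbit
   of the group they generate: a path is a single cycle of the permutation
   x |-> u (t x), and a cycle splits into two of them, exchanged by t. Hence
   2C + P is the number of cycles of x |-> u (t x). For a|b over c|d this
   permutation is the rotation by b + c of Z/(a + b). For d over a|b|c it
   exchanges three intervals, and is the map induced on {0, ..., d - 1} by the
   rotation by a + b of Z/(a + 2b + c). In both cases its orbits are the residue
   classes modulo gcd(a + b, b + c). *)
Require Import Defs.
From mathcomp Require Import all_boot all_order all_algebra all_fingroup zify.

Set Implicit Arguments.
Unset Strict Implicit.
Unset Printing Implicit Defensive.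

(** * Graphs of two involutions: components against orbits of the product *)

Section InvolutionGraph.
Variables (V : finType) (f : bool -> {perm V}).
Hypothesis fK : forall l, involutive (f l).

Definition flip_graph : {set bool * {set V}} :=
  [set e | [exists x, (f e.1 x != x) && (e.2 == [set x; f e.1 x])]].

Lemma mem_flip_graph l x y :
  ((l, [set x; y]) \in flip_graph) = (x != y) && (f l x == y).
Proof.
rewrite inE; apply/existsP/andP => [[z /andP[/= zf /eqP E]]|[xy /eqP fx]]; last first.
  by exists x; rewrite /= fx eq_sym xy eqxx.
have /set2P xz : x \in [set z; f l z] by rewrite -E set21.
have /set2P yz : y \in [set z; f l z] by rewrite -E set22.
have xy : x != y.
  by have := cards2 x y; rewrite E cards2 eq_sym zf; case: (x != y).
split=> //; move: xy; case: xz => ->; case: yz => ->; by rewrite ?fK ?eqxx.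
Qed.

(** Closed form of the walk applying [f b] and [f (~~ b)] in turn; through it, repetitions on the
    walk reduce to exponents on an orbit. *)
Definition walk b x i := if odd i then f b (((f b * f (~~ b))%g ^+ i./2)%g x)
  else ((f b * f (~~ b))%g ^+ i./2)%g x.

Lemma walkS b x i : walk b x i.+1 = f (b (+) odd i) (walk b x i).
Proof.
rewrite /walk /= uphalf_half; case: (odd i) => /=; last by rewrite addbF.
by rewrite add1n expgSr !permM addbT.
Qed.

(* The sequence w traverses K along M edges, alternating the two labels, the
   first one being b; w_alt prevents two edges with the same label from
   coinciding with opposite orientations. *)
Section Walk.
Variables (K : {set V}) (b : bool) (w : nat -> V) (M : nat).
Hypothesis wS : forall i, i < M -> w i.+1 = f (b (+) odd i) (w i).
Hypothesis wN : forall i, i < M -> w i.+1 != w i.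
Hypothesis wK : forall i, i <= M -> w i \in K.
Hypothesis w_inj : forall i j, i < M -> j < M -> w i = w j -> i = j.
Hypothesis w_alt : forall i j, i < M -> j < M -> w i = w j.+1 -> odd i != odd j.
Hypothesis w_cover : forall l x, x \in K -> f l x != x ->
  exists i, [/\ i < M, l = b (+) odd i & x = w i \/ x = w i.+1].

Definition walk_edges := [seq (b (+) odd i, [set w i; w i.+1]) | i <- iota 0 M].

Lemma perm_walk_edges : perm_eq walk_edges (enum (edges_in flip_graph K)).
Proof.
apply: uniq_perm; rewrite ?enum_uniq //.
  rewrite map_inj_in_uniq ?iota_uniq // => i j.
  rewrite !mem_iota !add0n => /andP[_ iM] /andP[_ jM].
  case=> /addbI oij /setP /(_ (w i)); rewrite !inE eqxx /= => /esym/orP[] /eqP.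
    exact: w_inj.
  by move/w_alt => /(_ iM jM); rewrite oij eqxx.
move=> [l e]; rewrite mem_enum inE /=; apply/mapP/idP => [[i]|].
  rewrite mem_iota add0n => /andP[_ iM] [-> ->].
  rewrite mem_flip_graph eq_sym wN // wS // eqxx /= -wS //.
  by apply/subsetP => z; rewrite !inE => /orP[] /eqP ->; apply: wK => //; apply: ltnW.
case/andP; rewrite inE => /existsP[x /andP[/= xf /eqP ->]] /subsetP sub.
have [] := w_cover (sub x _) xf; first by rewrite !inE eqxx.
move=> i [iM lE xE]; exists i; first by rewrite mem_iota add0n.
rewrite lE; congr (_, _); case: xE => ->; first by rewrite wS.
by rewrite wS // fK setUC.
Qed.

Lemma joins_walk : joins (w 0) [seq w i.+1 | i <- iota 0 M] walk_edges.
Proof.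
rewrite /joins /walk_edges -map_comp; apply/eqP.
elim: M 0 => [|m IH] k //=; congr (_ :: _); exact: IH.
Qed.

Lemma perm_walk m : {in gtn m &, injective w} ->
  (forall i, i < m -> w i \in K) -> #|K| = m ->
  perm_eq [seq w i | i <- iota 0 m] (enum K).
Proof.
move=> inj mem cK.
have U : uniq [seq w i | i <- iota 0 m].
  by rewrite map_inj_in_uniq ?iota_uniq // => i j; rewrite !mem_iota !add0n; apply: inj.
apply: uniq_perm; rewrite ?enum_uniq //.
have := uniq_min_size U _; case/(_ (enum K)) => //.
  by move=> x /mapP[i]; rewrite mem_iota add0n mem_enum => im ->; apply: mem.
by rewrite size_map size_iota -cardE cK.
Qed.

Lemma is_path_walk : #|K| = M.+1 -> {in gtn M.+1 &, injective w} -> is_path flip_graph K.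
Proof.
move=> cK inj.
have sp : size [seq w i.+1 | i <- iota 0 M] == #|K|.-1 by rewrite size_map size_iota cK.
have sq : size walk_edges == #|K|.-1 by rewrite size_map size_iota cK.
apply/existsP; exists (w 0); apply/existsP; exists (Tuple sp).
apply/existsP; exists (Tuple sq).
rewrite perm_walk_edges joins_walk !andbT /=.
have := @perm_walk M.+1 inj wK cK.
by rewrite /= (iotaDl 1 0) -map_comp.
Qed.

Lemma is_cycle_walk : #|K| = M -> 0 < M -> w M = w 0 -> is_cycle flip_graph K.
Proof.
move=> cK M0 wM.
have sp : size [seq w i.+1 | i <- iota 0 M.-1] == #|K|.-1 by rewrite size_map size_iota cK.
have sq : size walk_edges == #|K| by rewrite size_map size_iota cK.
apply/existsP; exists (w 0); apply/existsP; exists (Tuple sp).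
apply/existsP; exists (Tuple sq).
rewrite perm_walk_edges /=; apply/andP; split.
  have := @perm_walk M w_inj (fun i iM => wK (ltnW iM)) cK.
  by rewrite -{1}(prednK M0) /= (iotaDl 1 0) -map_comp.
have := joins_walk; rewrite -{1}(prednK M0) -addn1 iotaD map_cat /= add0n cats1.
by rewrite (prednK M0) wM.
Qed.
End Walk.

Let s := (f true * f false)%g.

(** Counting edges separates the two: a path has one edge fewer than vertices, a cycle as many. For
    empty [K] the truncated [#|K|.-1] would equal [#|K|]. *)
Lemma path_not_cycle (K : {set V}) :
  K != set0 -> is_path flip_graph K -> is_cycle flip_graph K = false.
Proof.
rewrite -card_gt0 => K0 /existsP[x /existsP[p /existsP[q /and3P[_ pq _]]]].
apply/negbTE/negP => /existsP[x' /existsP[p' /existsP[q' /and3P[_ pq' _]]]].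
by have := perm_size pq; rewrite -(perm_size pq') !size_tuple; lia.
Qed.

(** The dihedral relation: conjugation by [f true] inverts [s], written without inverses. *)
Lemma s_conj x : s (f true (s x)) = f true x.
Proof. by rewrite /s !permM !fK. Qed.

Lemma flip_iter i x : (s ^+ i)%g (f true ((s ^+ i)%g x)) = f true x.
Proof.
elim: i => [|i IH]; first by rewrite expg0 !perm1.
by rewrite {1}expgS (permM s) expgSr (permM _ s) s_conj IH.
Qed.

Lemma porbit_flip x : f true @: porbit s x = porbit s (f true x).
Proof.
have sub y : f true @: porbit s y \subset porbit s (f true y).
  apply/subsetP => _ /imsetP[_ /porbitP[i ->] ->].
  by rewrite porbit_sym; apply/porbitP; exists i; rewrite flip_iter.
apply/eqP; rewrite eqEsubset sub /=; apply/subsetP => y /(imset_f (f true)).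
move/(subsetP (sub _)); rewrite fK => /(imset_f (f true)); by rewrite fK.
Qed.

Definition orbit_closure (O : {set V}) := O :|: f true @: O.

Lemma orbit_closureE x : orbit_closure (porbit s x) = porbit s x :|: porbit s (f true x).
Proof. by rewrite /orbit_closure porbit_flip. Qed.

Lemma mem_closure_flip l x y :
  y \in orbit_closure (porbit s x) -> f l y \in orbit_closure (porbit s x).
Proof.
rewrite !orbit_closureE !inE -!eq_porbit_mem => H.
have -> : porbit s (f l y) = porbit s (f true y).
  case: l => //; apply/eqP; rewrite eq_porbit_mem; apply/porbitP; exists 1.
  by rewrite expg1 permM fK.
by case/orP: H => /eqP E; apply/orP; [right|left]; rewrite -!porbit_flip E ?porbit_flip ?fK.
Qed.

(** Closures are stable under both involutions, hence under adjacency; conversely, each power of [s]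
    is a run of edges, with pauses at fixed points. *)
Lemma components_flip : components flip_graph = orbit_closure @: porbits s.
Proof.
have adjE x y : adjacent flip_graph x y -> exists l, y = f l x.
  by case/existsP => l; rewrite mem_flip_graph => /andP[_ /eqP <-]; exists l.
have con l x : connect (adjacent flip_graph) x (f l x).
  have [E|N] := eqVneq x (f l x); first by rewrite -E connect0.
  by apply: connect1; apply/existsP; exists l; rewrite mem_flip_graph N eqxx.
have cs x i : connect (adjacent flip_graph) x ((s ^+ i)%g x).
  elim: i => [|i IH]; first by rewrite expg0 perm1.
  rewrite expgSr permM /s permM; apply: connect_trans IH _.
  by apply: connect_trans (con true _) (con false _).
rewrite /porbits -imset_comp; apply: eq_imset => x; apply/setP => y.
rewrite inE /=; apply/idP/idP.
  have step p : forall x', x' \in orbit_closure (porbit s x) ->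
      path (adjacent flip_graph) x' p -> last x' p \in orbit_closure (porbit s x).
    elim: p => //= z p IH x' x'K /andP[/adjE[l ->]]; apply: IH; exact: mem_closure_flip.
  case/connectP => p pp ->; apply: step pp.
  by rewrite orbit_closureE inE porbit_id.
rewrite orbit_closureE inE => /orP[] /porbitP[i ->] //.
exact: connect_trans (con true _) (cs _ _).
Qed.

(** For the final count: a component absorbs two orbits, or a single one if [f true] preserves
    it. *)
Lemma closure_fiber x :
  [set O in porbits s | orbit_closure O == orbit_closure (porbit s x)] =
  [set porbit s x; porbit s (f true x)].
Proof.
apply/setP => O; rewrite !inE; apply/andP/orP => [[/imsetP[y _ ->]]|].
  rewrite !orbit_closureE => /eqP/setP/(_ y).
  by rewrite !in_setU porbit_id /= !eq_porbit_mem => /esym/orP.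
case=> /eqP->; rewrite imset_f //; split=> //.
by rewrite !orbit_closureE fK setUC.
Qed.

Lemma porbit_expP (t : {perm V}) x y :
  reflect (exists2 i, i < #|porbit t x| & y = (t ^+ i)%g x) (y \in porbit t x).
Proof.
rewrite porbit_traject; apply: (iffP trajectP) => -[i im ->]; exists i => //; by rewrite permX.
Qed.

Lemma porbit_exp_inj (t : {perm V}) x :
  {in gtn #|porbit t x| &, injective (fun i => (t ^+ i)%g x)}.
Proof.
move=> i j; rewrite !inE => im jm /=.
rewrite !permX -(nth_traject t im) -(nth_traject t jm) => /eqP.
by rewrite nth_uniq ?size_traject ?uniq_traject_porbit // => /eqP.
Qed.

Lemma expg_porbit (t : {perm V}) x : (t ^+ #|porbit t x|)%g x = x.
Proof. by rewrite permX iter_porbit. Qed.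

(** Even steps of the walk stay in the orbit of [x], odd steps in its disjoint mirror image, so the
    walk first closes up after twice the orbit size. *)
Lemma is_cycle_closure x : f true x \notin porbit s x ->
  is_cycle flip_graph (orbit_closure (porbit s x)).
Proof.
move=> fx; set m := #|porbit s x|.
have m0 : 0 < m by apply/card_gt0P; exists x; apply: porbit_id.
have wE i : walk true x i = if odd i then f true ((s ^+ i./2)%g x) else (s ^+ i./2)%g x by [].
have dis y : y \in porbit s x -> f true y \in porbit s x = false.
  rewrite -!eq_porbit_mem -porbit_flip => /eqP ->; rewrite porbit_flip eq_porbit_mem.
  exact: negbTE.
have memw i : (walk true x i \in porbit s x) = ~~ odd i.
  by rewrite wE; case: (odd i); rewrite ?dis // mem_porbit.
have alt i j : walk true x i = walk true x j -> odd i = odd j.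
  by move=> E; apply: negb_inj; rewrite -!memw E.
have wM : walk true x m.*2 = walk true x 0.
  by rewrite !wE odd_double doubleK expg0 perm1 expg_porbit.
apply: (@is_cycle_walk _ true (walk true x) m.*2).
- by move=> i _; rewrite walkS.
- by move=> i _; apply/eqP => /alt /=; case: (odd i).
- move=> i _; rewrite orbit_closureE inE wE; case: (odd i); last by rewrite mem_porbit.
  by rewrite -porbit_flip imset_f ?orbT // mem_porbit.
- move=> i j im jm E; have o := alt _ _ E; move: E; rewrite !wE -o => E.
  rewrite -(odd_double_half i) -(odd_double_half j) o; congr (_ + _.*2).
  apply: (@porbit_exp_inj s x); rewrite ?inE -/m; [lia|lia|].
  by move: E; case: (odd i) => // /perm_inj.
- by move=> i j _ _ /alt /= ->; case: (odd j).
- move=> l y yK _.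
  have [i im ->] : exists2 i, i < m.*2 & y = walk true x i.
    move: yK; rewrite orbit_closureE -porbit_flip => /setUP[|/imsetP[z zx ->]].
      case/porbit_expP => j jm ->.
      by exists j.*2; [rewrite ltn_double | rewrite wE odd_double doubleK].
    case/porbit_expP: zx => j jm ->; exists j.*2.+1; first by rewrite -/m in jm; lia.
    by rewrite wE /= odd_double /= uphalf_double.
  have [E|N] := eqVneq l (true (+) odd i); first by exists i; split; [| |left].
  (* The edge with the other label is the one just traversed; at position 0 it is the closing
     edge. *)
  case: i im N => [|i] im N.
    exists m.*2.-1; split; [lia| |right]; last by rewrite prednK ?wM //; lia.
    by move: N; rewrite -subn1 oddB ?odd_double; [case: l|lia].
  exists i; split; [lia| |by right].
  by move: N => /=; case: l; case: (odd i).
- rewrite orbit_closureE cardsU -porbit_flip card_imset; last exact: perm_inj.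
  rewrite (_ : _ :&: _ = set0) ?cards0 ?subn0 ?addnn //.
  by apply/setP => y; rewrite !inE; apply/andP => -[] y1 /imsetP[z zx E]; rewrite E dis in y1.
- lia.
- exact: wM.
Qed.

(** A point fixed by one involution is an end: the walk starting with the other involution covers
    the whole orbit before it turns back. *)
Lemma is_path_porbit b v :
  f (~~ b) v = v -> is_path flip_graph (porbit (f b * f (~~ b))%g v).
Proof.
move=> fv; set t := (f b * f (~~ b))%g; set m := #|porbit t v|.
have m0 : 0 < m by apply/card_gt0P; exists v; apply: porbit_id.
have tK y : t (f b (t y)) = f b y by rewrite /t !permM !fK.
(* The walk from v visits v, t^-1 v, t v, t^-2 v, t^2 v, and so on. *)
have flipE j : j < m -> f b ((t ^+ j)%g v) = (t ^+ (m.-1 - j))%g v.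
  elim: j => [|j IH] jm; apply: (@perm_inj _ t); rewrite -[RHS]permM -expgSr.
    by rewrite subn0 prednK // expg_porbit expg0 perm1 permM fK.
  rewrite [in LHS]expgSr (permM _ t) tK IH ?(ltnW jm) //.
  by congr ((t ^+ _)%g v); lia.
pose e i := if odd i then m.-1 - i./2 else i./2.
have wE i : i <= m -> walk b v i = (t ^+ e i)%g v.
  by move=> im; rewrite /walk /e -/t; case: ifP => // o; rewrite flipE //; lia.
have inj : {in gtn m &, injective (walk b v)}.
  have e_lt i : i < m -> e i < m by rewrite /e; case: (odd i); lia.
  move=> i j; rewrite !inE => im jm; rewrite (wE i (ltnW im)) (wE j (ltnW jm)) => E.
  have := porbit_exp_inj (e_lt _ im) (e_lt _ jm) E; rewrite /e.
  by case oi: (odd i); case oj: (odd j); lia.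
have mE : m = m.-1.+1 by rewrite prednK.
apply: (@is_path_walk _ b (walk b v) m.-1).
- by move=> i _; rewrite walkS.
- by move=> i im; apply/eqP => /inj; rewrite !inE; lia.
- by move=> i im; rewrite wE ?mem_porbit //; lia.
- by move=> i j im jm /inj; rewrite !inE; lia.
- by move=> i j im jm /inj; rewrite !inE => -> //=; [case: (odd j)|lia|lia].
- move=> l y /porbit_expP[r]; rewrite -/m => rm -> yf.
  have [i im yE] : exists2 i, i < m & (t ^+ r)%g v = walk b v i.
    (* Exponents below half of [m] sit at even positions of the walk, the others at odd ones. *)
    have [lt|ge] := ltnP r.*2 m.
      by exists r.*2 => //; rewrite wE /e ?odd_double ?doubleK // ltnW.
    exists (m.-1 - r).*2.+1; first lia.
    by rewrite wE /e /= ?odd_double /= ?uphalf_double; [congr ((t ^+ _)%g v)|]; lia.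
  move: yf; rewrite yE => yf.
  have [E|N] := eqVneq l (b (+) odd i).
    exists i; split; [|by []|by left]; rewrite ltn_neqAle; apply/andP; split; last lia.
    (* At the last position the next edge would be a loop, since [e m = e m.-1]: the far end is a
       fixed point too. *)
    apply: contraNneq yf => iM; rewrite E -walkS !wE; [|lia|lia].
    have im1 : i.+1 = m by lia.
    by apply/eqP; congr ((t ^+ _)%g v); rewrite /e /= -im1 /=; case oi: (odd i) => /=; lia.
  case: i im N yf {yE} => [|i] im N yf.
    case/eqP: yf; rewrite (_ : l = ~~ b); last by case: (l) (b) N => [] [].
    by rewrite /walk /= expg0 perm1.
  exists i; split; [lia| |by right].
  by move: N => /=; case: (l) (b) (odd i) => [] [] [].
- by rewrite -mE.
- by rewrite -mE.
Qed.

(* If f true x = s^j x, then f true reverses the orbit of x as i |-> j - i does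
   for the exponents; the middle of this reflection is an end of the path. *)
Lemma exists_end x : f true x \in porbit s x ->
  exists b, exists2 v, v \in porbit s x & f (~~ b) v = v.
Proof.
case/porbitP => j jE; pose i := j./2; have ij := odd_double_half j.
case o: (odd j) ij => ij.
  exists true, ((s ^+ i.+1)%g x); first exact: mem_porbit.
  have -> : f (~~ true) ((s ^+ i.+1)%g x) = f true ((s ^+ i)%g x).
    by rewrite expgSr permM [in LHS]/s permM fK.
  apply: (@perm_inj _ (s ^+ i)%g); rewrite flip_iter jE -permM -expgD.
  by congr ((s ^+ _)%g x); lia.
exists false, ((s ^+ i)%g x); first exact: mem_porbit.
apply: (@perm_inj _ (s ^+ i)%g); rewrite flip_iter jE -permM -expgD.
by congr ((s ^+ _)%g x); lia.
Qed.

(** The product in the other order is the inverse of [s], so a path may be walked from an end of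
    either kind. *)
Lemma porbit_turn b x : porbit (f b * f (~~ b))%g x = porbit s x.
Proof.
case: b => //=; rewrite -(porbitV s); congr (porbit _ x).
apply/permP => y; apply: (@perm_inj _ s); rewrite permKV.
by rewrite /s !permM !fK.
Qed.

Lemma cycles_paths_porbits :
  2 * num_cycles flip_graph + num_paths flip_graph = #|porbits s|.
Proof.
rewrite /num_cycles /num_paths -!sum1dep_card -[RHS]sum1_card !big_mkcondr /=.
(* Orbits are grouped by component; it remains to match twice the cycle indicator plus the path
   indicator with the fibre size, 2 or 1. *)
rewrite components_flip [RHS](partition_big_imset orbit_closure) big_distrr -big_split /=.
apply: eq_bigr => _ /imsetP[_ /imsetP[x _ ->] ->].
rewrite sum1dep_card closure_fiber cards2 eq_porbit_mem porbit_sym.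
have K0 : orbit_closure (porbit s x) != set0.
  by apply/set0Pn; exists x; rewrite orbit_closureE inE porbit_id.
case: (boolP (f true x \in porbit s x)) => fx.
  have [b [v vx fv]] := exists_end fx.
  have P : is_path flip_graph (orbit_closure (porbit s x)).
    have -> : orbit_closure (porbit s x) = porbit (f b * f (~~ b))%g v.
      rewrite porbit_turn orbit_closureE; move: fx vx.
      rewrite -!eq_porbit_mem => /eqP-> /eqP->.
      exact: setUid.
    exact: is_path_porbit.
  by rewrite P (path_not_cycle K0 P).
have C := is_cycle_closure fx.
case P: (is_path _ _); first by rewrite (path_not_cycle K0 P) in C.
by rewrite C.
Qed.
End InvolutionGraph.

(** * Meanders as graphs of two block reversals *)

Fixpoint block_flip (s : seq nat) (x : nat) : nat :=
  if s is a :: s' then if x < a then a.-1 - x else a + block_flip s' (x - a)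
  else x.

Lemma block_flip_lt s x : x < sumn s -> block_flip s x < sumn s.
Proof.
elim: s x => //= a s IH x; case: (ltnP x a) => [xa|ax] xs; first lia.
by rewrite ltn_add2l IH //; lia.
Qed.

Lemma block_flipK : forall s, involutive (block_flip s).
Proof.
elim=> //= a s IH x; case: (ltnP x a) => ax.
  by rewrite ifT; lia.
by rewrite ifF ?addKn ?IH; lia.
Qed.

Lemma block_arcP s x y :
  (exists2 j, j < size s & exists i, [/\ block_first s j + i < block_last s j - i,
     x = block_first s j + i & y = block_last s j - i])
  <-> x < y /\ y = block_flip s x.
Proof.
elim: s x y => [|a s IH] x y /=.
  by split=> [[]//|[]]; lia.
(* [block_last] is a truncated predecessor, so the shift by [a] needs a nonzero prefix sum, which an
   arc guarantees. *)
have lastE j : block_first s j < block_last s j ->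
    block_last (a :: s) j.+1 = a + block_last s j.
  by rewrite /block_last /block_first /=; lia.
have firstE j : block_first (a :: s) j.+1 = a + block_first s j by [].
split.
  case=> -[_ [i []]|j js [i []]].
    rewrite /block_first /block_last /= take0 /= => lt -> ->.
    by rewrite ifT; lia.
  rewrite firstE => lt xE yE.
  have lt' : block_first s j < block_last s j.
    by move: lt; rewrite /block_last /block_first /=; lia.
  rewrite lastE // in lt yE.
  rewrite ifF; last lia.
  have [|_ E] := (IH (x - a) (y - a)).1.
    by exists j => //; exists i; split; lia.
  by rewrite -E; lia.
case: (ltnP x a) => ax [xy yE].
  by exists 0 => //; exists x; rewrite /block_first /block_last /= take0 /=; split; lia.
have [|j js [i [lt xE yE']]] := (IH (x - a) (y - a)).2; first by split; lia.
exists j.+1 => //; exists i; rewrite firstE lastE; last lia.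
by split; lia.
Qed.

Lemma is_arcE n s (x y : 'I_n) : is_arc s x y = (x < y) && (y == block_flip s x :> nat).
Proof.
apply/existsP/andP => [[j /existsP[i /and3P[lt /eqP xE /eqP yE]]]|[xy /eqP yE]].
  have [|xy yf] := (block_arcP s x y).1; last by split; last apply/eqP.
  by exists j; [exact: ltn_ord | exists i].
have [|j js [i [lt xE yE']]] := (block_arcP s x y).2; first by [].
have ix : i < n by apply: leq_ltn_trans (ltn_ord x); rewrite xE leq_addl.
exists (Ordinal js); apply/existsP; exists (Ordinal ix).
by rewrite /= lt xE yE' !eqxx.
Qed.

(** A value outside ['I_n] is replaced by [x] itself, so this is an involution even when the sum of
    [s] is not [n]. *)
Definition ord_flip n s (x : 'I_n) : 'I_n := insubd x (block_flip s x).

Lemma ord_flipK n s : involutive (@ord_flip n s).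
Proof.
move=> x; apply: val_inj; rewrite /ord_flip !val_insubd /=.
by case: (ltnP (block_flip s x) n) => lt; rewrite ?block_flipK ?ltn_ord // ltnNge lt.
Qed.

Definition perm_flip n s : {perm 'I_n} := perm (can_inj (@ord_flipK n s)).

Lemma perm_flipK n s : involutive (perm_flip n s).
Proof. by move=> x; rewrite !permE ord_flipK. Qed.

Lemma val_perm_flip n s (x : 'I_n) :
  sumn s = n -> perm_flip n s x = block_flip s x :> nat.
Proof. by move=> sn; rewrite permE val_insubd -{2}sn block_flip_lt ?sn. Qed.

Definition meander_flip n top bot (l : bool) := perm_flip n (if l then top else bot).

Lemma meander_flip_graph top bot : sumn bot = sumn top ->
  meander top bot = flip_graph (meander_flip (sumn top) top bot).
Proof.
move=> tb; set n := sumn top; apply/setP => -[l e].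
have -> : ((l, e) \in meander top bot) = (e \in arcs n (if l then top else bot)).
  rewrite inE; apply/orP/idP => [|eA].
    by case=> /imsetP[e' eA [-> ->]].
  by case: l eA => eA; [left|right]; apply: imset_f.
have flE x : meander_flip n top bot l x = block_flip (if l then top else bot) x :> nat.
  by rewrite val_perm_flip //; case: l.
have fK := perm_flipK (n := n) (if l then top else bot).
apply/imset2P/idP => [[x y _]|].
  rewrite inE /= is_arcE -flE => /andP[xy /eqP/val_inj yE] ->.
  by rewrite mem_flip_graph; [rewrite -yE eqxx neq_ltn xy | move=> b; apply: perm_flipK].
rewrite inE => /existsP[x /= /andP[xf /eqP ->]].
(* [is_arc] orients arcs from left to right, so the smaller endpoint must come first. *)
move: xf; rewrite neq_ltn => /orP[] lt; last first.
  by exists x (meander_flip n top bot l x); rewrite // inE /= is_arcE lt flE eqxx.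
exists (meander_flip n top bot l x) x; rewrite // ?inE /= ?is_arcE ?lt -?flE ?fK ?eqxx //.
by rewrite setUC.
Qed.

Lemma meander_index_porbits top bot : sumn bot = sumn top ->
  meander_index top bot =
  (#|porbits (perm_flip (sumn top) top * perm_flip (sumn top) bot)%g|%:Z - 1)%R.
Proof.
move=> tb; rewrite /meander_index meander_flip_graph // cycles_paths_porbits //.
by move=> l; apply: perm_flipK.
Qed.

(** * Orbits of an induced rotation *)

(* The permutation s is the map induced on {0, ..., n - 1} by the rotation by k
   of Z/N, with return times 1 or 2. *)
Section Rotation.
Variables (n N k : nat) (s : {perm 'I_n}).
Hypothesis N_gt0 : 0 < N.
Hypothesis nN : n <= N.
Hypothesis gn : gcdn k N <= n.
Hypothesis sE : forall x : 'I_n, s x = (x + k) %% N :> nat \/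
  n <= (x + k) %% N /\ s x = ((x + k) %% N + k) %% N :> nat.

(** The gcd divides [k] and [N], so neither a rotation nor the reduction modulo [N] changes the
    residue. *)
Lemma rotation_porbit_mod x y : y \in porbit s x -> x = y %[mod gcdn k N].
Proof.
case/porbitP => i ->; elim: i => [|i IH]; first by rewrite expg0 perm1.
rewrite expgSr permM {}IH; move: ((s ^+ i)%g x) => z.
have modk m : (m + k) %% N = m %[mod gcdn k N].
  by rewrite modn_dvdm ?dvdn_gcdr // -modnDmr (eqP (dvdn_gcdl k N)) addn0.
by case: (sE z) => [|[_]] ->; rewrite !modk.
Qed.

(** Strong induction on the number [i] of rotations: each application of [s] uses up one or two of
    them. *)
Lemma rotation_reach i (x y : 'I_n) : y = (x + i * k) %% N :> nat -> y \in porbit s x.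
Proof.
have stp z w : z \in porbit s (s w) -> z \in porbit s w.
  by rewrite -!eq_porbit_mem => /eqP->; rewrite -[s w]/((s ^+ 1)%g w) porbit_perm.
have [m] := ubnP i; elim: m i x => // m IH [|i] x im yE.
  rewrite addn0 modn_small in yE; last by apply: leq_trans (ltn_ord x) nN.
  by rewrite (val_inj yE) porbit_id.
apply: stp; case: (sE x) => [sx|[out sx]].
  by apply: (IH i); rewrite // sx modnDml yE -addnA mulSn.
(* A single remaining rotation would put [y] at or beyond [n], which is absurd. *)
case: i im yE => [|i] im yE.
  by have := ltn_ord y; rewrite yE mul1n ltnNge out.
apply: (IH i); [lia | rewrite yE sx modnDml -[in RHS]addnA modnDml !mulSn].
by congr (_ %% _); lia.
Qed.

Lemma rotation_mod_porbit (x y : 'I_n) : x = y %[mod gcdn k N] -> y \in porbit s x.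
Proof.
move=> xy; have [a _ /dvdnP[r rE]] := Bezoutr k N_gt0.
have yxN : y <= x + N by have := ltn_ord y; lia.
have : gcdn k N %| x + N - y.
  by rewrite -eqn_mod_dvd // -modnDmr (eqP (dvdn_gcdr k N)) addn0 xy.
(* By Bezout [a * k] is minus the gcd modulo [N], and [x + N - y] is [q] times the gcd, so [a * q]
   rotations take [x] to [y]. *)
case/dvdnP => q qE; apply: (@rotation_reach (a * q)).
rewrite -[LHS](@modn_small _ N); last by have := ltn_ord y; lia.
rewrite -(modnMDl (r * q) y N) -[RHS](modnDr _ N); congr (_ %% _).
rewrite mulnAC -rE; nia.
Qed.

(** Orbits correspond to residues modulo the gcd, and by [gn] each least residue is a point of
    ['I_n]. *)
Lemma card_porbits_rotation : #|porbits s| = gcdn k N.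
Proof.
have g0 : 0 < gcdn k N by rewrite gcdn_gt0 N_gt0 orbT.
have -> : porbits s = [set porbit s (widen_ord gn r) | r : 'I_(gcdn k N)].
  apply/setP => O; apply/imsetP/imsetP => -[x _ ->]; last by exists (widen_ord gn x).
  exists (Ordinal (ltn_pmod x g0)) => //; apply/eqP; rewrite eq_porbit_mem.
  by apply: rotation_mod_porbit; rewrite /= modn_mod.
rewrite card_imset ?card_ord // => r r' /eqP.
rewrite eq_porbit_mem => /rotation_porbit_mod /=.
by rewrite !modn_small // => /val_inj.
Qed.
End Rotation.

(** * The two block types as induced rotations *)

Theorem theorem15 (a b c d : nat)
    (ha : 0 < a) (hb : 0 < b) (hc : 0 < c) (hd : 0 < d) :
  (d = a + b + c ->
     meander_index [:: d] [:: a; b; c] = ((gcdn (a + b) (b + c))%:Z - 1)%R)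
  /\
  (a + b = c + d ->
     meander_index [:: a; b] [:: c; d] = ((gcdn (a + b) (b + c))%:Z - 1)%R).
Proof.
have modE N y : y < N + N -> y %% N = if y < N then y else y - N.
  case: (ltnP y N) => [/modn_small //|Ny yN].
  by rewrite -{1}(subnK Ny) modnDr modn_small //; lia.
split=> E.
  have bt : sumn [:: a; b; c] = sumn [:: d] by rewrite /=; lia.
  rewrite meander_index_porbits //; congr (_%:Z - 1)%R.
  (* The rotation is by [a + b] modulo [a + 2b + c]; subtracting [a + b] from the modulus leaves the
     gcd with [b + c]. *)
  have NE : (a + b) + (b + c) = sumn [:: d] + b by rewrite /=; lia.
  rewrite -gcdnDl NE; apply: card_porbits_rotation; rewrite -?NE ?gcdnDl.
  - lia.
  - rewrite /=; lia.
  - by apply: leq_trans (dvdn_leq _ (dvdn_gcdl _ _)) _; rewrite /=; lia.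
  move=> x; rewrite permM !val_perm_flip //.
  have := ltn_ord x; move: (nat_of_ord x) => {}x; rewrite /= addn0 => xd.
  rewrite (modE _ (x + _)); last lia.
  rewrite !modE; last by case: ifP; lia.
  (* The points with [c <= x < b + c] pass through the [b] extra points and need two rotations; all
     others need one. *)
  by rewrite xd; repeat (case: ltnP => ?; try lia).
have bt : sumn [:: c; d] = sumn [:: a; b] by rewrite /=; lia.
rewrite meander_index_porbits //; congr (_%:Z - 1)%R.
rewrite gcdnC; have NE : a + b = sumn [:: a; b] by rewrite /=; lia.
rewrite {1}NE; apply: card_porbits_rotation; rewrite -?NE //.
- lia.
- by apply: dvdn_leq; [lia | exact: dvdn_gcdr].
move=> x; left; rewrite permM !val_perm_flip; [|by rewrite /=; lia..].
have := ltn_ord x; move: (nat_of_ord x) => {}x; rewrite /= => xd.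
(* [x + b + c] may reach twice the modulus, so the rotation is split into one by [b] and one by
   [c]. *)
rewrite addnA -modnDml (modE _ (x + b)); last lia.
rewrite modE; last by case: ifP; lia.
case: (ltnP (x + b)) => xb;
  (case: (ltnP x a) => xa; [|case: (ltnP (x - a) b) => xab; last lia]);
  by repeat (case: ltnP => ?; try lia).
Qed.
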